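(* Let $N\in\mathbb{N}=\{1,2,\dots\}$. Then for all $z,w\in\mathbb{C}$, $$K_{RBF,N}(z,w)=K_{RBF}(z,w)\,L^1_{N-1}\left(\frac{|z-w|^2}{2}\right).$$
   Context: For $m,n\in\mathbb{N}_0$ the complex Itô–Hermite polynomials are $$H_{m,n}(z,\overline{z})=\sum_{j=0}^{\min(m,n)}(-1)^j j!\binom{m}{j}\binom{n}{j}z^{n-j}\,\overline{z}^{\,m-j}.$$ Put $$(T_{m,p}\psi_n)(z):=\frac{1}{\sqrt{m!\,n!}}\,e^{-\frac{z^2}{4}}\,H_{m,n}\left(\frac{z}{\sqrt2},\frac{\overline{z}}{\sqrt2}\right),\quad z\in\mathbb{C}.$$ The true polyanalytic Gaussian RBF kernel of order $\ell\in\mathbb{N}$ is $$\mathsf{K}_{\ell,T}(z,w):=\sum_{n=0}^{\infty}(T_{\ell-1,p}\psi_n)(z)\,\overline{(T_{\ell-1,p}\psi_n)(w)},$$ and the polyanalytic Gaussian RBF kernel of order $N$ is $K_{RBF,N}(z,w):=\sum_{m=1}^{N}\mathsf{K}_{m,T}(z,w)$. The Gaussian RBF kernel is $K_{RBF}(z,w)=\exp\left(-\frac{(z-\overline{w})^2}{4}\right)$. The generalized Laguerre polynomials are $L^\beta_k(x)=\sum_{j=0}^{k}(-1)^j\binom{k+\beta}{k-j}\frac{x^j}{j!}$. *)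

(* Defs.v *)
From HB Require Import structures.
From mathcomp Require Import all_boot all_order all_algebra.
From mathcomp Require Import all_classical all_reals all_analysis.
From mathcomp Require Import complex.
Set Implicit Arguments.
Unset Strict Implicit.
Unset Printing Implicit Defensive.
Import Order.TTheory GRing.Theory Num.Theory.
Import numFieldNormedType.Exports.
Local Open Scope classical_set_scope.
Local Open Scope ring_scope.

(* The type [R[i]] carries no topology of its own in the libraries: its usual
   (normed) topology is found on the convertible alias [R[i]^o]. *)

Definition cexp (R : realType) (z : R[i]) : R[i] :=
  (expR (complex.Re z))%:C%C * (cos (complex.Im z) +i* sin (complex.Im z))%C.

(* The two arguments are to be instantiated with a point and its conjugate. *)
Definition ito_hermite (R : realType) (m n : nat) (z zbar : R[i]) : R[i] :=
  \sum_(0 <= j < (minn m n).+1)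
    (-1) ^+ j * (j`! * 'C(m, j) * 'C(n, j))%:R * z ^+ (n - j) * zbar ^+ (m - j).

(* [T_psi m n] is the function T_{m,p} psi_n. *)
Definition T_psi (R : realType) (m n : nat) (z : R[i]) : R[i] :=
  ((Num.sqrt (m`! * n`!)%:R)^-1)%:C%C * cexp (- (z ^+ 2 / 4)) *
  ito_hermite m n (z / (Num.sqrt 2)%:C%C) (z^* / (Num.sqrt 2)%:C%C).

Definition true_kernel_partial_sum (R : realType) (l : nat) (z w : R[i]) :
    nat -> R[i]^o :=
  series (fun n => T_psi l.-1 n z * (T_psi l.-1 n w)^* : R[i]^o).

(* The true polyanalytic Gaussian RBF kernel of order [l >= 1]. *)
Definition true_poly_rbf_kernel (R : realType) (l : nat) (z w : R[i]) : R[i] :=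
  limn (true_kernel_partial_sum l z w).

Definition poly_rbf_kernel (R : realType) (N : nat) (z w : R[i]) : R[i] :=
  \sum_(1 <= l < N.+1) true_poly_rbf_kernel l z w.

Definition rbf_kernel (R : realType) (z w : R[i]) : R[i] :=
  cexp (- ((z - w^*) ^+ 2 / 4)).

(* The generalized Laguerre polynomial L^beta_k, for a natural number beta. *)
Definition laguerre (F : fieldType) (beta k : nat) (x : F) : F :=
  \sum_(0 <= j < k.+1) (-1) ^+ j * 'C(k + beta, k - j)%:R * (x ^+ j / j`!%:R).

(* Main.v *)
Require Import Defs.
From mathcomp Require Import all_boot all_order all_algebra.
From mathcomp Require Import all_classical all_reals all_analysis.
From mathcomp Require Import complex.
From mathcomp Require Import zify ring.
Set Implicit Arguments.
Unset Strict Implicit.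
Unset Printing Implicit Defensive.
Import Order.TTheory GRing.Theory Num.Theory.
Import numFieldNormedType.Exports.
Local Open Scope classical_set_scope.
Local Open Scope ring_scope.

(** Write a = z / sqrt 2 and a' for its conjugate, b' = w / sqrt 2 and b for its
    conjugate.  Conjugating an Ito-Hermite polynomial conjugates both of its
    arguments, so the true kernel of order m + 1 is, up to 1 / m! and Gaussian
    factors, the series over n of H_{m,n}(a, a') H_{m,n}(b, b') / n!.  The four
    numbers may be treated as independent, and the heart of the proof is the identity
      sum_n H_{m,n}(a, a') H_{m,n}(b, b') / n!
        = m! e^{ab} L_m((a - b') (a' - b)),
    [cvg_series_ito_hermite].

    Expanding both polynomials, the dependence on n sits in the products
    n^_j n^_k a^{n-j} b^{n-k} / n!.  The Vandermonde convolution rewrites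
    n^_j n^_k as a combination of falling factorials of order j + k - i
    ([ffact_linearization]); each of these turns (ab)^n / n! into a shifted term
    of the exponential series of ab, hence sums to e^{ab}.  So the series
    converges to e^{ab} times a finite triple sum over (j, k, i).  For fixed i
    that sum splits as a sum over j times a sum over k, each evaluated by the
    binomial theorem ([sum_signed_bin_bin]), and what remains is the Laguerre
    polynomial ([triple_sum_laguerre]).

    The Gaussian factors and e^{ab} = e^{z w^* / 2} combine into
    e^{-(z - w^* )^2 / 4}, and L^0_0 + ... + L^0_{N-1} = L^1_{N-1} by Pascal's
    rule ([sum_laguerre0]).

    The analytic ingredient is that [cexp], defined through the real
    exponential, cosine and sine, is the sum of the exponential series
    ([cvg_exp_partial]).  The real and imaginary axes are covered by the real
    series, and the two are glued by the addition formula for the series: the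
    defect S_n(x) S_n(y) - S_n(x + y) is a sum of monomials with nonnegative
    coefficients, so it is dominated by the same defect at |x| and |y|, which
    tends to 0 by the addition formula for the real exponential. *)

(** * Products of falling factorials and Laguerre sums *)

(** The exponential series delayed by [s] steps: its total sum does not depend
    on [s]. *)
Definition shifted_exp_term (F : fieldType) (x : F) (s n : nat) : F :=
  if (s <= n)%N then x ^+ (n - s) / (n - s)`!%:R else 0.

Lemma fact_neq0 (F : numFieldType) n : n`!%:R != 0 :> F.
Proof. by rewrite pnatr_eq0 -lt0n fact_gt0. Qed.

Lemma bin_factE (F : numFieldType) (n k : nat) : (k <= n)%N ->
  'C(n, k)%:R = n`!%:R / (k`!%:R * (n - k)`!%:R) :> F.
Proof.
by move=> k_le_n; rewrite -(bin_fact k_le_n) !natrM mulfK.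
Qed.

(** The left-hand side is what differentiating j times in [a] and k times in [b]
    makes of the term (ab)^n / n! of e^{ab}; the right-hand side is the corresponding
    part of the Leibniz expansion.  Combinatorially it is the Vandermonde split
    of a k-subset of n points by a fixed j-subset, [i] being the size of the
    intersection. *)
Lemma ffact_linearization (F : numFieldType) (a b : F) (j k n : nat) :
  (j`! * 'C(n, j))%:R * a ^+ (n - j) * ((k`! * 'C(n, k))%:R * b ^+ (n - k))
    / n`!%:R =
  \sum_(i < k.+1) ('C(j, i) * 'C(k, i) * i`!)%:R * a ^+ (k - i) * b ^+ (j - i)
     * shifted_exp_term (a * b) (j + k - i) n.
Proof.
have [n_lt_j|j_le_n] := ltnP n j.
  (* Then n < j + k - i as well, since i <= k. *)
  rewrite bin_small // muln0 !mul0r big1 // => -[i /=]; rewrite ltnS => i_le _.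
  by rewrite /shifted_exp_term leqNgt (_ : (n < _)%N) ?mulr0 //; lia.
have -> : 'C(n, k) = (\sum_(i < k.+1) 'C(j, i) * 'C(n - j, k - i))%N.
  by rewrite binomial.Vandermonde subnKC.
rewrite big_distrr /= natr_sum mulr_suml mulr_sumr mulr_suml.
apply: eq_bigr => -[i /=]; rewrite ltnS => i_le_k _.
have [j_lt_i|i_le_j] := ltnP j i.
  by rewrite (bin_small j_lt_i) !mul0n muln0 !(mul0r, mulr0).
rewrite /shifted_exp_term; case: leqP => [s_le|s_gt]; last first.
  by rewrite (@bin_small (n - j)) ?muln0 ?mul0r ?mulr0 ?mul0r //; lia.
(* Name the Venn cells: i common points, p and q private ones, r outside. *)
have [p kE] : exists p, k = (i + p)%N by exists (k - i)%N; lia.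
have [q jE] : exists q, j = (i + q)%N by exists (j - i)%N; lia.
have [r nE] : exists r, n = (i + p + q + r)%N by exists (n - (i + p + q))%N; lia.
have nj : (n - j)%N = (p + r)%N by lia.
have nk : (n - k)%N = (q + r)%N by lia.
have ki : (k - i)%N = p by lia.
have ji : (j - i)%N = q by lia.
have ns : (n - (j + k - i))%N = r by lia.
rewrite !natrM (bin_factE F j_le_n) (bin_factE F i_le_k) nj nk ki ji ns.
rewrite (bin_factE F (leq_addr r p)) addKn exprMn !exprD.
field.
by rewrite !fact_neq0.
Qed.

(** The trinomial revision C(m,j) C(j,i) = C(m,i) C(m-i,j-i) leaves a binomial
    expansion of (u - v)^(m-i). *)
Lemma sum_signed_bin_bin (F : comPzRingType) (u v : F) (m i : nat) : (i <= m)%N ->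
  \sum_(j < m.+1) (-1) ^+ j * ('C(m, j) * 'C(j, i))%:R * u ^+ (m - j)
     * v ^+ (j - i) =
  (-1) ^+ i * 'C(m, i)%:R * (u - v) ^+ (m - i).
Proof.
move=> i_le_m.
rewrite -(big_mkord xpredT (fun j => (-1) ^+ j * ('C(m, j) * 'C(j, i))%:R
  * u ^+ (m - j) * v ^+ (j - i))).
rewrite (@big_cat_nat _ _ _ i) //=; last by lia.
rewrite big_nat big1 ?add0r; last first.
  by move=> j /andP[_ j_lt]; rewrite (bin_small j_lt) muln0 mulr0 !mul0r.
rewrite -{1}(add0n i) big_addn subSn // big_mkord exprDn mulr_sumr.
apply: eq_bigr => -[j /= j_lt] _.
have -> : ('C(m, j + i) * 'C(j + i, i) = 'C(m, i) * 'C(m - i, j))%N.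
  apply/eqP; rewrite -(eqn_pmul2r (fact_gt0 i)) -(eqn_pmul2r (fact_gt0 j)).
  rewrite -(eqn_pmul2r (fact_gt0 (m - i - j))); apply/eqP.
  have h1 := @bin_fact m (j + i) ltac:(lia).
  have h2 := @bin_fact (j + i) i ltac:(lia).
  have h3 := @bin_fact m i i_le_m.
  have h4 := @bin_fact (m - i) j ltac:(lia).
  rewrite addnK in h2; rewrite (_ : m - (j + i) = m - i - j)%N in h1; last lia.
  transitivity m`!.
    by rewrite -h1 -h2 !mulnA.
  by rewrite -h3 -h4; lia.
rewrite addnK (_ : m - (j + i) = m - i - j)%N; last lia.
rewrite (exprNn v) exprD -mulr_natr natrM; ring.
Qed.

(** Pascal's rule, coefficientwise. *)
Lemma sum_laguerre0 (F : fieldType) (x : F) (N : nat) :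
  \sum_(m < N.+1) laguerre 0 m x = laguerre 1 N x.
Proof.
elim: N => [|N IH].
  by rewrite big_ord1 /laguerre !big_nat1 !bin0.
rewrite big_ord_recr /= {}IH /laguerre !big_mkord.
rewrite [in RHS]big_ord_recr [X in _ + X]big_ord_recr /= !subnn !bin0 addrA.
congr (_ + _); rewrite -big_split; apply: eq_bigr => -[i /= i_lt] _.
rewrite addn0 !addn1 subSn //; rewrite (binS N.+1) natrD; ring.
Qed.

(** * Products of Ito-Hermite polynomials *)

(** Letting [j] run up to [m] rather than [minn m n] makes the range independent
    of [n], so that sums over [j] can be exchanged with the series over [n]. *)
Lemma ito_hermiteE (R : realType) (m n : nat) (a a' : R[i]) :
  ito_hermite m n a a' =
  \sum_(j < m.+1) (-1) ^+ j * 'C(m, j)%:R * a' ^+ (m - j) *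
    ((j`! * 'C(n, j))%:R * a ^+ (n - j)).
Proof.
rewrite /ito_hermite big_mkord.
rewrite (big_ord_widen_cond m.+1 xpredT (fun j => (-1) ^+ j *
  (j`! * 'C(m, j) * 'C(n, j))%:R * a ^+ (n - j) * a' ^+ (m - j))) ?ltnS ?geq_minl //.
rewrite big_mkcond; apply: eq_bigr => -[j /= j_lt] _.
case: ltnP => [_|j_gt]; first by rewrite !natrM; ring.
by rewrite (@bin_small n) ?muln0 ?mul0r ?mulr0 //; lia.
Qed.

(** The coefficients are arranged so that, for fixed [i], the first factor
    depends on [j] and the second on [k] alone, while [n] only occurs in the
    last factor. *)
Lemma ito_hermite_mul (R : realType) (m n : nat) (a a' b b' : R[i]) :
  ito_hermite m n a a' * ito_hermite m n b b' / n`!%:R =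
  \sum_(j < m.+1) \sum_(k < m.+1) \sum_(i < m.+1)
    ((-1) ^+ j * ('C(m, j) * 'C(j, i))%:R * a' ^+ (m - j) * b ^+ (j - i)) *
    ((-1) ^+ k * ('C(m, k) * 'C(k, i))%:R * b' ^+ (m - k) * a ^+ (k - i)) *
    i`!%:R * shifted_exp_term (a * b) (j + k - i) n.
Proof.
rewrite !ito_hermiteE mulr_suml mulr_suml; apply: eq_bigr => j _.
rewrite mulr_sumr mulr_suml; apply: eq_bigr => -[k /= k_lt] _.
transitivity ((-1) ^+ j * 'C(m, j)%:R * a' ^+ (m - j) *
   ((-1) ^+ k * 'C(m, k)%:R * b' ^+ (m - k)) *
   ((j`! * 'C(n, j))%:R * a ^+ (n - j) * ((k`! * 'C(n, k))%:R * b ^+ (n - k))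
    / n`!%:R)).
  ring.
rewrite ffact_linearization.
rewrite (big_ord_widen_cond m.+1 xpredT (fun i => ('C(j, i) * 'C(k, i) * i`!)%:R
  * a ^+ (k - i) * b ^+ (j - i) * shifted_exp_term (a * b) (j + k - i) n)) //.
rewrite big_mkcond mulr_sumr; apply: eq_bigr => -[i /= i_lt] _.
case: ltnP => [_|i_gt]; first by rewrite !natrM; ring.
by rewrite (bin_small i_gt) muln0 !(mul0r, mulr0).
Qed.

(** After the sums over [j] and [k] are evaluated, the signs cancel and the term
    of index [i] is i! C(m,i)^2 ((a' - b)(b' - a))^(m-i), which is m! times the
    Laguerre term of degree m - i. *)
Lemma triple_sum_laguerre (F : numFieldType) (m : nat) (a a' b b' : F) :
  \sum_(j < m.+1) \sum_(k < m.+1) \sum_(i < m.+1)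
    ((-1) ^+ j * ('C(m, j) * 'C(j, i))%:R * a' ^+ (m - j) * b ^+ (j - i)) *
    ((-1) ^+ k * ('C(m, k) * 'C(k, i))%:R * b' ^+ (m - k) * a ^+ (k - i)) *
    i`!%:R = m`!%:R * laguerre 0 m ((a - b') * (a' - b)).
Proof.
under eq_bigr do rewrite exchange_big.
rewrite exchange_big /=.
rewrite /laguerre big_mkord mulr_sumr [RHS](reindex_inj rev_ord_inj) /=.
apply: eq_bigr => -[i /=]; rewrite ltnS => i_le _.
under eq_bigr do rewrite -mulr_suml -mulr_sumr.
rewrite -!mulr_suml !sum_signed_bin_bin //.
rewrite addn0 subSS subKn //.
transitivity ((-1) ^+ i * (-1) ^+ i * i`!%:R * 'C(m, i)%:R * 'C(m, i)%:R *
  (- 1 * ((a - b') * (a' - b))) ^+ (m - i)).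
  rewrite (_ : -1 * _ = (a' - b) * (b' - a)); last by ring.
  rewrite exprMn; ring.
rewrite -expr2 -exprM mulnC exprM sqrrN !expr1n mul1r exprMn.
rewrite {1}(bin_factE F i_le).
field.
by rewrite !fact_neq0.
Qed.

(** * The complex exponential series *)

Lemma cvg_real_complex (R : realType) (f : nat -> R) (a : R) :
  f n @[n --> \oo] --> a ->
  ((f n)%:C%C : R[i]^o) @[n --> \oo] --> (a%:C%C : R[i]^o).
Proof.
move=> fa; apply/cvgrPdist_lt => e e_gt0.
have eE : e = (complex.Re e)%:C%C by rewrite RRe_real // gtr0_real.
have Re_gt0 : 0 < complex.Re e by rewrite -ltcR -eE.
move/cvgrPdist_lt : fa => /(_ _ Re_gt0); apply: filterS => n.
by rewrite -rmorphB normc_def /= expr0n addr0 sqrtr_sqr eE ltcR.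
Qed.

Lemma cvg_series_exp_coeff (R : realType) (x : R) :
  series (exp_coeff x) n @[n --> \oo] --> expR x.
Proof. exact: is_cvg_series_exp_coeff. Qed.

Definition exp_partial (F : fieldType) (n : nat) (x : F) : F :=
  \sum_(k < n) x ^+ k / k`!%:R.

Lemma exp_partial_ge0 (F : numFieldType) (n : nat) (x : F) :
  0 <= x -> 0 <= exp_partial n x.
Proof. by move=> x_ge0; apply: sumr_ge0 => k _; rewrite divr_ge0 ?exprn_ge0. Qed.

(** What the product of partial sums has and the partial sum at [x + y] misses:
    the monomials of the n-by-n square above its antidiagonal. *)
Lemma exp_partial_mulB (F : numFieldType) (n : nat) (x y : F) :
  exp_partial n x * exp_partial n y - exp_partial n (x + y) =
  \sum_(i < n) \sum_(j < n | (n <= i + j)%N)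
    x ^+ i / i`!%:R * (y ^+ j / j`!%:R).
Proof.
apply/eqP; rewrite subr_eq; apply/eqP.
have -> : exp_partial n (x + y) = \sum_(i < n) \sum_(j < n | ~~ (n <= i + j)%N)
    x ^+ i / i`!%:R * (y ^+ j / j`!%:R).
  (* Group the square below the antidiagonal by total degree k = i + j. *)
  transitivity (\sum_(0 <= k < n) \sum_(0 <= i < n | (i <= k)%N)
      x ^+ i / i`!%:R * (y ^+ (k - i) / (k - i)`!%:R)).
    rewrite /exp_partial big_mkord; apply: eq_bigr => -[k /= k_lt] _.
    rewrite addrC exprDn mulr_suml big_mkord.
    rewrite (big_ord_widen_cond n xpredT (fun i => (y ^+ (k - i) * x ^+ i *+ 'C(k, i))
       / k`!%:R)) //.
    apply: eq_bigr => -[i /= _]; rewrite ltnS => i_le.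
    rewrite -(bin_fact i_le) -mulr_natr !natrM.
    field.
    by rewrite !fact_neq0 pnatr_eq0 -lt0n bin_gt0.
  rewrite (exchange_big_dep_nat xpredT) //= big_mkord.
  apply: eq_bigr => -[i /= i_lt] _.
  rewrite -(big_nat_widenl i 0 n xpredT) //.
  rewrite -{1}(add0n i) big_addn.
  rewrite -(big_mkord (fun j => ~~ (n <= i + j)%N)
    (fun j => x ^+ i / i`!%:R * (y ^+ j / j`!%:R))).
  rewrite (big_nat_widen _ _ n) ?leq_subr //.
  apply: eq_big => j; first by rewrite /=; lia.
  by rewrite addnK.
rewrite /exp_partial mulr_suml -big_split /=; apply: eq_bigr => i _.
by rewrite mulr_sumr (bigID (fun j : 'I_n => n <= i + j)%N).
Qed.

(** This domination reduces the complex addition formula to the real one. *)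
Lemma exp_partial_mulB_le (F : numFieldType) (n : nat) (x y : F) :
  `|exp_partial n x * exp_partial n y - exp_partial n (x + y)| <=
  exp_partial n `|x| * exp_partial n `|y| - exp_partial n (`|x| + `|y|).
Proof.
rewrite !exp_partial_mulB; apply: le_trans (ler_norm_sum _ _ _) _.
apply: ler_sum => i _; apply: le_trans (ler_norm_sum _ _ _) _.
apply: ler_sum => j _.
by rewrite !normrM !normfV !normrX !normr_nat.
Qed.

Lemma cvg_exp_partialD (R : realType) (x y a b : R[i]) :
  (exp_partial n x : R[i]^o) @[n --> \oo] --> (a : R[i]^o) ->
  (exp_partial n y : R[i]^o) @[n --> \oo] --> (b : R[i]^o) ->
  (exp_partial n (x + y) : R[i]^o) @[n --> \oo] --> (a * b : R[i]^o).
Proof.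
move=> xa yb.
pose r := Normc.normc x; pose s := Normc.normc y.
have real_exp (t : R) : exp_partial n t @[n --> \oo] --> expR t.
  have := @cvg_series_exp_coeff R t; apply: cvg_trans; apply: near_eq_cvg.
  by apply: nearW => n; rewrite /series /= big_mkord.
have defect : exp_partial n r * exp_partial n s - exp_partial n (r + s)
    @[n --> \oo] --> (0 : R).
  rewrite -(subrr (expR (r + s))) {1}expRD.
  by apply: cvgB => //; apply: cvgM.
have toC n (t : R) : exp_partial n (t%:C%C : R[i]) = (exp_partial n t)%:C%C.
  rewrite /exp_partial rmorph_sum; apply: eq_bigr => k _.
  by rewrite rmorphM rmorphXn fmorphV rmorph_nat.
have Cdefect := cvg_real_complex defect.
have small : (exp_partial n x * exp_partial n y
    - exp_partial n (x + y) : R[i]^o) @[n --> \oo] --> (0 : R[i]^o).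
  move/cvgrPdist_lt : Cdefect => Cdefect; apply/cvgrPdist_lt => e e_gt0.
  move: (Cdefect e e_gt0); apply: filterS => n; rewrite !sub0r !normrN.
  apply: le_lt_trans.
  apply: le_trans (exp_partial_mulB_le _ _ _) _.
  apply: le_trans (real_ler_norm _) _.
  rewrite realB ?realM ?ger0_real
    1?mulr_ge0 ?exp_partial_ge0 ?addr_ge0 //.
  have normE (u : R[i]) : `|u| = (Normc.normc u)%:C%C by case: u.
  by rewrite !normE -rmorphD !toC -rmorphM -rmorphB.
have xyab := @cvgM R[i] _ _ _ _ _ a b xa yb.
rewrite -[a * b]subr0 (_ : (fun n => _) = (fun n => exp_partial n x * exp_partial n y
  - (exp_partial n x * exp_partial n y - exp_partial n (x + y)) : R[i]^o)).
  exact: cvgB (xyab _) small.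
by apply/funext => n; rewrite subKr.
Qed.

Lemma cexpD (R : realType) (x y : R[i]) : cexp (x + y) = cexp x * cexp y.
Proof.
case: x y => [a b] [c d]; rewrite /cexp /= expRD cosD sinD.
by apply/eqP; rewrite eq_complex; simpc; apply/andP; split; apply/eqP ; rewrite /=; ring.
Qed.

Lemma cexp_conj (R : realType) (z : R[i]) : (cexp z)^* = cexp z^*.
Proof.
case: z => [a b]; rewrite /cexp /=.
rewrite cosN sinN; apply/eqP; rewrite eq_complex /=; apply/andP.
by split; apply/eqP; ring.
Qed.

Lemma cvg_complex (R : realType) (f g : nat -> R) (a b : R) :
  f n @[n --> \oo] --> a -> g n @[n --> \oo] --> b ->
  ((f n +i* g n)%C : R[i]^o) @[n --> \oo] --> ((a +i* b)%C : R[i]^o).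
Proof.
move=> fa gb.
have i_cst : ('i%C : R[i]^o) @[n --> \oo] --> ('i%C : R[i]^o) by apply: cvg_cst.
have igb := @cvgM R[i] _ _ _ _ _ _ _ i_cst (cvg_real_complex gb).
rewrite (_ : (a +i* b)%C = a%:C%C + 'i%C * b%:C%C); last by simpc.
rewrite (_ : (fun n => _) = (fun n => (f n)%:C%C + 'i%C * (g n)%:C%C : R[i]^o)).
  exact: cvgD (cvg_real_complex fa) (igb _).
by apply/funext => n; simpc.
Qed.

(** The shape matches the definitions of the cosine and sine series. *)
Lemma expr_i (R : realType) (k : nat) :
  ('i%C : R[i]) ^+ k = (((~~ odd k)%:R * (-1) ^+ k./2) +i*
                        ((odd k)%:R * (-1) ^+ k.-1./2))%C.
Proof.
rewrite -{1}[k]odd_double_half exprD -mul2n exprM sqr_i.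
have -> : (-1) ^+ k./2 = ((-1) ^+ k./2)%:C%C :> R[i] by rewrite rmorphXn rmorphN1.
case: (boolP (odd k)) => k_odd /=.
  rewrite expr1; have -> : (k.-1)./2 = k./2 by lia.
  apply/eqP; rewrite eq_complex /=; apply/andP; split; apply/eqP; ring.
rewrite expr0.
by apply/eqP; rewrite eq_complex /=; apply/andP; split; apply/eqP; ring.
Qed.

(** Split [z] into its real and imaginary parts; each has a known real series. *)
Lemma cvg_exp_partial (R : realType) (z : R[i]) :
  (exp_partial n z : R[i]^o) @[n --> \oo] --> (cexp z : R[i]^o).
Proof.
case: z => a b.
have -> : (a +i* b)%C = a%:C%C + 'i%C * b%:C%C by simpc.
rewrite cexpD; apply: cvg_exp_partialD.
  rewrite /cexp /= cos0 sin0 mulr1.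
  have := cvg_real_complex (@cvg_series_exp_coeff R a).
  rewrite (_ : (fun n => _) = (fun n => exp_partial n a%:C%C : R[i]^o)) //.
  apply/funext => n; rewrite /series /= big_mkord rmorph_sum.
  by apply: eq_bigr => k _; rewrite rmorphM rmorphXn fmorphV rmorph_nat.
have -> : cexp ('i%C * b%:C%C) = (cos b +i* sin b)%C.
  by rewrite /cexp; simpc; rewrite /= expR0; simpc.
have cosP : series (cos_coeff b) n @[n --> \oo] --> cos b.
  by rewrite unlock; exact: is_cvg_series_cos_coeff.
have sinP : series (sin_coeff b) n @[n --> \oo] --> sin b.
  by rewrite unlock; exact: is_cvg_series_sin_coeff.
have := cvg_complex cosP sinP.
rewrite (_ : (fun n => _) = (fun n => exp_partial n ('i%C * b%:C%C) : R[i]^o)) //.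
apply/funext => n; rewrite /series /= !big_mkord /exp_partial.
elim: n => [|n IH]; first by rewrite !big_ord0.
rewrite !big_ord_recr /= -IH exprMn expr_i.
rewrite -(rmorph_nat (real_complex R)) -fmorphV -rmorphXn -mulrA -rmorphM.
by rewrite /cos_coeff /sin_coeff /=; simpc; rewrite -exprnP !mulrA.
Qed.

Lemma cvg_series_shifted_exp_term (R : realType) (x : R[i]) (s : nat) :
  (series (shifted_exp_term x s : nat -> R[i]^o) n : R[i]^o) @[n --> \oo] -->
  (cexp x : R[i]^o).
Proof.
rewrite -(cvg_shiftn s).
have := @cvg_exp_partial R x.
rewrite (_ : (fun n => _) =
  (fun n => series (shifted_exp_term x s : nat -> R[i]^o) (n + s)%N)) //.
apply/funext => n; rewrite /series /= (@big_cat_nat _ _ _ s) ?leq_addl //=.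
rewrite big_nat big1 ?add0r; last first.
  by move=> k /andP[_ k_lt]; rewrite /shifted_exp_term leqNgt k_lt.
rewrite -{1}(add0n s) big_addn addnK big_mkord; apply: eq_bigr => k _.
by rewrite /shifted_exp_term leq_addl addnK.
Qed.

(** * Summing the kernels *)

Lemma cvg_series_sum (R : realType) (I : Type) (r : seq I)
    (u : I -> nat -> R[i]) (l : I -> R[i]) :
  (forall i, (series (u i : nat -> R[i]^o) n : R[i]^o)
    @[n --> \oo] --> (l i : R[i]^o)) ->
  (series (fun k => \sum_(i <- r) u i k : R[i]^o) n : R[i]^o) @[n --> \oo] -->
    (\sum_(i <- r) l i : R[i]^o).
Proof.
move=> ul.
rewrite (_ : (fun n => _) =
  (fun n => \sum_(i <- r) series (u i : nat -> R[i]^o) n)); last first.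
  by apply/funext => n; rewrite /series /= exchange_big.
elim: r => [|i r IH].
  rewrite big_nil (_ : (fun n => _) = (fun n => 0)); first exact: cvg_cst.
  by apply/funext => n; rewrite big_nil.
rewrite big_cons (_ : (fun n => _) = (fun n => series (u i : nat -> R[i]^o) n +
  \sum_(i0 <- r) series (u i0 : nat -> R[i]^o) n)).
  exact: cvgD (ul i) IH.
by apply/funext => n; rewrite big_cons.
Qed.

Lemma cvg_seriesM (R : realType) (c : R[i]) (u : nat -> R[i]) (l : R[i]) :
  (series (u : nat -> R[i]^o) n : R[i]^o) @[n --> \oo] --> (l : R[i]^o) ->
  (series (fun k => c * u k : R[i]^o) n : R[i]^o) @[n --> \oo] --> (c * l : R[i]^o).
Proof.
move=> ul.
have c_cst : (c : R[i]^o) @[n --> \oo] --> (c : R[i]^o) by apply: cvg_cst.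
rewrite (_ : (fun n => _) = (fun n => c * series (u : nat -> R[i]^o) n : R[i]^o)).
  exact: (@cvgM R[i] _ _ _ _ _ _ _ c_cst ul).
by apply/funext => n; rewrite /series /= mulr_sumr.
Qed.

(** Only finitely many shifted exponential series are involved, all with the
    same sum e^{ab}, so the limit factors out. *)
Lemma cvg_series_ito_hermite (R : realType) (m : nat) (a a' b b' : R[i]) :
  (series (fun n => ito_hermite m n a a' * ito_hermite m n b b' / n`!%:R : R[i]^o) n
    : R[i]^o) @[n --> \oo] -->
  (m`!%:R * laguerre 0 m ((a - b') * (a' - b)) * cexp (a * b) : R[i]^o).
Proof.
have -> := funext (fun n => ito_hermite_mul m n a a' b b').
rewrite -triple_sum_laguerre.
rewrite mulr_suml; refine (@cvg_series_sum R _ _ _ _ _) => j.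
rewrite mulr_suml; refine (@cvg_series_sum R _ _ _ _ _) => k.
rewrite mulr_suml; refine (@cvg_series_sum R _ _ _ _ _) => i.
by apply: cvg_seriesM; exact: cvg_series_shifted_exp_term.
Qed.

Lemma ito_hermite_conj (R : realType) (m n : nat) (a a' : R[i]) :
  (ito_hermite m n a a')^* = ito_hermite m n a^* a'^*.
Proof.
rewrite /ito_hermite rmorph_sum; apply: eq_bigr => j _.
by rewrite !rmorphM !rmorphXn rmorphN1 /= !rmorph_nat.
Qed.

(** Conjugation only reaches the point [w], where it swaps [w] and [w^*] in the
    Ito-Hermite polynomial; the normalizing square roots square to 1/(m! n!). *)
Lemma T_psi_mul (R : realType) (m n : nat) (z w : R[i]) :
  let r := (Num.sqrt 2)%:C%C : R[i] in
  T_psi m n z * (T_psi m n w)^* =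
  m`!%:R^-1 * cexp (- (z ^+ 2 / 4)) * cexp (- (w^* ^+ 2 / 4)) *
  (ito_hermite m n (z / r) (z^* / r) * ito_hermite m n (w^* / r) (w / r) / n`!%:R).
Proof.
move=> r; rewrite /T_psi -/r; set q := Num.sqrt _.
have conjR (t : R) : (t%:C%C : R[i])^* = t%:C%C by exact: conjc_real.
have qq : q%:C%C ^+ 2 = m`!%:R * n`!%:R :> R[i].
  by rewrite -rmorphXn sqr_sqrtr // natrM rmorphM !rmorph_nat.
have div_r u : (u / r)^* = u^* / r by rewrite rmorphM fmorphV /= conjR.
have expw : (- (w ^+ 2 / 4))^* = - (w^* ^+ 2 / 4) :> R[i].
  by rewrite rmorphN rmorphM rmorphXn fmorphV /= rmorph_nat.
rewrite 2!(rmorphM Num.conj) /= cexp_conj ito_hermite_conj conjR !div_r expw.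
rewrite conjCK fmorphV /= -/q; move: q%:C%C qq => {}q qq.
transitivity ((q ^+ 2)^-1 * (cexp (- (z ^+ 2 / 4)) * cexp (- (w^* ^+ 2 / 4)) *
  (ito_hermite m n (z / r) (z^* / r) * ito_hermite m n (w^* / r) (w / r)))).
  rewrite expr2 invfM; ring.
rewrite qq invfM; ring.
Qed.

(** The order [l = m.+1] of the true kernel is shifted by one from the Laguerre
    degree.  Completing the square combines the three exponentials. *)
Lemma cvg_true_kernel (R : realType) (m : nat) (z w : R[i]) :
  true_kernel_partial_sum m.+1 z w n @[n --> \oo] -->
  (rbf_kernel z w * laguerre 0 m (`|z - w| ^+ 2 / 2) : R[i]^o).
Proof.
rewrite /true_kernel_partial_sum /=.
have -> := funext (fun n => T_psi_mul m n z w).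
set r := (Num.sqrt 2)%:C%C.
have rr : r * r = 2 :> R[i].
  by rewrite -rmorphM -expr2 sqr_sqrtr // rmorph_nat.
have := @cvg_seriesM R
  (m`!%:R^-1 * cexp (- (z ^+ 2 / 4)) * cexp (- (w^* ^+ 2 / 4))) _ _
  (@cvg_series_ito_hermite R m (z / r) (z^* / r) (w^* / r) (w / r)).
suff -> : m`!%:R^-1 * cexp (- (z ^+ 2 / 4)) * cexp (- (w^* ^+ 2 / 4)) *
  (m`!%:R * laguerre 0 m ((z / r - w / r) * (z^* / r - w^* / r)) *
    cexp (z / r * (w^* / r))) =
  rbf_kernel z w * laguerre 0 m (`|z - w| ^+ 2 / 2) by [].
have -> : (z / r - w / r) * (z^* / r - w^* / r) = `|z - w| ^+ 2 / 2.
  rewrite normCK rmorphB -rr invfM; ring.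
have -> : z / r * (w^* / r) = z * w^* / 2 by rewrite -rr invfM; ring.
have -> : rbf_kernel z w = cexp (- (z ^+ 2 / 4)) * cexp (- (w^* ^+ 2 / 4)) *
    cexp (z * w^* / 2).
  by rewrite -!cexpD /rbf_kernel; congr cexp; field.
field.
exact: fact_neq0.
Qed.

(* The first component says that the series defining the kernels converge,
   so that [limn] in their definition is a genuine sum. *)
Theorem proposition4p9 (R : realType) (N : nat) (hN : (1 <= N)%N)
    (z w : R[i]) :
  (forall l : nat, (1 <= l <= N)%N -> cvgn (true_kernel_partial_sum l z w)) /\
  poly_rbf_kernel N z w =
    rbf_kernel z w * laguerre 1 (N - 1) (`|z - w| ^+ 2 / 2).
Proof.
split=> [[//|m] _|]; first by apply/cvg_ex; eexists; exact: cvg_true_kernel.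
case: N hN => // N _.
rewrite /poly_rbf_kernel big_add1 big_mkord subn1 -sum_laguerre0 mulr_sumr.
apply: eq_bigr => m _.
apply: (cvg_lim _ (@cvg_true_kernel R m z w)).
exact: norm_hausdorff.
Qed.
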